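(* Let $n \geq 1$, $I = \{1,\dots,n\}$, $g \in \mathbb{R}^n$ and $G \subseteq I$. Then the output $x \in \mathbb{R}^n$ of the Gradient Projection onto Simplex algorithm (described in the context) on input $(g, G, n)$ is the optimal solution of the problem $$\text{minimize}_{x \in \mathbb{R}^n}\ \|x - g\|^2 \quad \text{subject to}\quad \sum_{i=1}^n x_i = 0, \qquad x_i \leq 0 \ \text{ for all } i \in G .$$ Moreover, when the sorting is carried out by a sorting algorithm with $O(n \log n)$ time complexity, the algorithm runs in $O(n\log n)$ time.
   Context: $\|\cdot\|$ is the Euclidean norm on $\mathbb{R}^n$. The sign constraints are imposed only on the coordinates whose index lies in $G$; the remaining coordinates are unconstrained in sign. The Gradient Projection onto Simplex algorithm, on input $(g,G,n)$, does the following. (1) Sort $g$ into descending order so that $g_1 \geq g_2 \geq \dots \geq g_n$; relabel the indices in $G$ to match the sorted $g$; sort $G$ into ascending order, and write $G_i$ for its $i$-th smallest element. (2) Set $s = \sum_{k=1}^n g_k$, $a = s/n$, $m = |G|$ and $H = \emptyset$. (3) For $i = 1,\dots,m$: if $g_{G_i} > a$, then replace $s$ by $s - g_{G_i}$, then replace $a$ by $s/(n-i)$, and replace $H$ by $H \cup \{G_i\}$; otherwise, exit the loop. (4) Set $x_i = g_i - a$ for $i \in I \setminus H$ and $x_i = 0$ for $i \in H$. (5) Reorder the entries of $x$ to match the original order of $g$ before sorting, and output $x$. Running time counts arithmetic operations and comparisons on real numbers at unit cost. *)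

(* Defs.v *)
From HB Require Import structures.
From mathcomp Require Import all_boot all_order all_algebra.
From mathcomp Require Import all_classical all_reals all_analysis.

Set Implicit Arguments.
Unset Strict Implicit.
Unset Printing Implicit Defensive.

Import Order.TTheory GRing.Theory Num.Theory.
Import numFieldNormedType.Exports.

Local Open Scope classical_set_scope.
Local Open Scope ring_scope.

(* The norm that MathComp-Analysis attaches to 'rV[R]_n is the sup norm, hence
   a separate Euclidean norm. *)
Definition enorm (R : realType) (n : nat) (x : 'rV[R]_n) : R :=
  Num.sqrt (\sum_(i < n) x 0 i ^+ 2).

Definition feasible (R : realType) (n : nat) (G : {set 'I_n}) (x : 'rV[R]_n)
    : Prop :=
  \sum_(i < n) x 0 i = 0 /\ forall i, i \in G -> x 0 i <= 0.

Definition optimal (R : realType) (n : nat) (g : 'rV[R]_n) (G : {set 'I_n})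
    (x : 'rV[R]_n) : Prop :=
  feasible G x /\
  forall y, feasible G y -> enorm (x - g) ^+ 2 <= enorm (y - g) ^+ 2.

(* Computations on a real random-access machine: a result together with the
   number of elementary operations spent on it.  Arithmetic operations and
   comparisons, on reals and on indices, cost one unit each, and so do array
   accesses and loop iterations; the running time therefore bounds in
   particular the number of operations on reals. *)
Definition timed (A : Type) : Type := (A * nat)%type.

Definition ret (A : Type) (x : A) : timed A := (x, 0%N).

Definition bind (A B : Type) (m : timed A) (f : A -> timed B) : timed B :=
  let r := f m.1 in (r.1, (m.2 + r.2)%N).

Definition op (A : Type) (x : A) : timed A := (x, 1%N).

Definition result (A : Type) (m : timed A) : A := m.1.
Definition running_time (A : Type) (m : timed A) : nat := m.2.

Notation "'let*' x ':=' m 'in' k" := (bind m (fun x => k))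
  (at level 200, x name, m at level 200, k at level 200, right associativity).

(* Arrays are sequences indexed from 0. *)
Definition alloc (A : Type) (n : nat) (x : A) : timed (seq A) := (nseq n x, n).
Definition read (A : Type) (x0 : A) (s : seq A) (i : nat) : timed A :=
  op (nth x0 s i).
Definition write (A : Type) (x0 : A) (s : seq A) (i : nat) (x : A)
    : timed (seq A) :=
  op (set_nth x0 s i x).

Fixpoint for_fold (A S : Type) (l : seq A) (z : S) (f : S -> A -> timed S)
    : timed S :=
  if l is x :: l' then
    let* _ := op tt in
    let* z' := f z x in
    for_fold l' z' f
  else ret z.

Fixpoint for_map (A B : Type) (l : seq A) (f : A -> timed B) : timed (seq B) :=
  if l is x :: l' then
    let* _ := op tt in
    let* y := f x in
    let* s := for_map l' f in
    ret (y :: s)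
  else ret [::].

(* A sorting algorithm takes a comparison function and an array.  The operation
   count of a run is part of the data and is not constrained here: results
   quantified over this type hold for any way of counting the operations of
   the sorting routine. *)
Record sorting_algorithm : Type := SortingAlgorithm {
  sort_run : forall T : eqType, rel T -> seq T -> timed (seq T);
  sort_run_perm : forall (T : eqType) (leT : rel T) (s : seq T),
    total leT -> transitive leT -> perm_eq (result (sort_run leT s)) s;
  sort_run_sorted : forall (T : eqType) (leT : rel T) (s : seq T),
    total leT -> transitive leT -> sorted leT (result (sort_run leT s))
}.

Definition O_nlogn (R : realType) (t : nat -> nat) : Prop :=
  (fun n => (t n)%:R : R^o) =O_\oo (fun n => n%:R * ln n%:R : R^o).

Definition nlogn_sorting (R : realType) (srt : sorting_algorithm) : Prop :=
  exists2 t : nat -> nat, O_nlogn R t &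
    forall (T : eqType) (leT : rel T) (s : seq T),
      total leT -> transitive leT ->
      (running_time (sort_run srt leT s) <= t (size s))%N.

Section Algorithm.

Variables (R : realFieldType) (srt : sorting_algorithm).

(* [gs] is the sorted array of pairs (entry of g, original index), [i] counts
   iterations from 1, [l] lists G_i, G_(i+1), up to G_m, and [H] is the
   characteristic array of the set H. *)
Fixpoint shrink_loop (n : nat) (gs : seq (R * nat)) (i : nat) (l : seq nat)
    (s a : R) (H : seq bool) : timed (R * seq bool) :=
  if l is k :: l' then
    let* _ := op tt in
    let* p := read (0, 0%N) gs k in
    let* b := op (a < p.1) in
    if b then
      let* s' := op (s - p.1) in
      let* d := op (n - i)%N in
      let* a' := op (s' / d%:R) in
      let* H' := write false H k true in
      let* i' := op i.+1 in
      shrink_loop n gs i' l' s' a' H'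
    else ret (a, H)
  else ret (a, H).

(* The set G is given as an array listing its elements.  Indices and positions
   range over 0, ..., n - 1. *)
Definition gps_array (g : seq R) (G : seq nat) (n : nat) : timed (seq R) :=
  let* tagged := for_map (iota 0 n)
    (fun j => let* v := read 0 g j in ret (v, j)) in
  let* gs := sort_run srt (fun p q : R * nat => q.1 <= p.1) tagged in
  let* pos0 := alloc n 0%N in
  let* pos := for_fold (iota 0 n) pos0
    (fun r k => let* p := read (0, 0%N) gs k in write 0%N r p.2 k) in
  let* G1 := for_map G (fun j => read 0%N pos j) in
  let* Gs := sort_run srt leq G1 in
  let* s := for_fold (iota 0 n) 0
    (fun z k => let* p := read (0, 0%N) gs k in op (z + p.1)) in
  let* a := op (s / n%:R) in
  let* H0 := alloc n false in
  let* aH := shrink_loop n gs 1 Gs s a H0 in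
  let* x := for_map (iota 0 n)
    (fun k => let* h := read false aH.2 k in
              if h then ret 0
              else let* p := read (0, 0%N) gs k in op (p.1 - aH.1)) in
  let* x0 := alloc n 0 in
  for_fold (iota 0 n) x0
    (fun r k => let* p := read (0, 0%N) gs k in
                let* v := read 0 x k in
                write 0 r p.2 v).

Definition gps (n : nat) (g : 'rV[R]_n) (G : {set 'I_n}) : timed (seq R) :=
  gps_array [seq g 0 i | i <- enum 'I_n] [seq val i | i <- enum G] n.

Definition gps_output (n : nat) (g : 'rV[R]_n) (G : {set 'I_n}) : 'rV[R]_n :=
  \row_(i < n) (result (gps g G))`_i.

End Algorithm.

(* Main.v *)
Require Import Defs.
From mathcomp Require Import all_boot all_order all_algebra.
From mathcomp Require Import all_classical all_reals all_analysis.
From mathcomp Require Import zify lra.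

Set Implicit Arguments.
Unset Strict Implicit.
Unset Printing Implicit Defensive.

Import Order.TTheory GRing.Theory Num.Theory.

(** Optimality is the sufficiency of the Karush-Kuhn-Tucker conditions.  A
    feasible point x is the strict minimizer as soon as some threshold a makes
    each coordinate either x_i = g_i - a, or x_i = 0 with i in G and a <= g_i:
    then a is the multiplier of the equality constraint, g_i - a >= 0 is the
    multiplier of a binding sign constraint, and
    |y - g|^2 >= |x - g|^2 + |y - x|^2 for every feasible y
    ([unique_optimal_shift]).

    The algorithm maintains such a threshold.  Throughout the loop, a is the
    average of the entries of g at the positions outside H.  A position joins H
    only if its entry exceeds that average, so its removal lowers a; hence
    entries frozen earlier still exceed the new a, and the final a is at most
    g_k for all k in H.  Since G is scanned by decreasing entries, the first
    entry that is at most a shows that all the remaining ones are too, that is,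
    x_k <= 0 on the part of G outside H.  That a is an average says exactly
    that the output sums to 0.  A last unfrozen entry equals its own average
    and is never removed, so no division by zero occurs
    ([shrink_loopP]).  The sorting permutation and its inverse transport these
    facts to the original order ([gps_arrayP]).

    For the running time, everything but the two sorts is linear
    ([running_time_gps_array]).  The second sort has size |G| <= n, and the time
    bound t for sorting need not be monotone, so it is replaced by its prefix
    maximum, which is still O(n log n) ([O_nlogn_prefix_max]). *)

(** * Timed computations *)

Section Timed.

Variables (A B S : Type).

Lemma result_bind (m : timed A) (f : A -> timed B) :
  result (bind m f) = result (f (result m)).
Proof. by []. Qed.

Lemma result_for_map (l : seq A) (f : A -> timed B) :
  result (for_map l f) = [seq result (f x) | x <- l].
Proof. by elim: l => //= x l <-. Qed.

Lemma result_for_fold (l : seq A) (z : S) (f : S -> A -> timed S) :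
  result (for_fold l z f) = foldl (fun z x => result (f z x)) z l.
Proof. by elim: l z => //= x l IH z; rewrite -IH. Qed.

Lemma running_time_bind (m : timed A) (f : A -> timed B) c1 c2 :
    (running_time m <= c1)%N -> (running_time (f (result m)) <= c2)%N ->
  (running_time (bind m f) <= c1 + c2)%N.
Proof. exact: leq_add. Qed.

Lemma running_time_for_map (l : seq A) (f : A -> timed B) c :
    (forall x, running_time (f x) <= c)%N ->
  (running_time (for_map l f) <= c.+1 * size l)%N.
Proof.
move=> fc; elim: l => //= x l; have := fc x.
rewrite /running_time /=; lia.
Qed.

Lemma running_time_for_fold (l : seq A) (z : S) (f : S -> A -> timed S) c :
    (forall z x, running_time (f z x) <= c)%N ->
  (running_time (for_fold l z f) <= c.+1 * size l)%N.
Proof.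
move=> fc; elim: l z => //= x l IH z; have := IH (result (f z x)).
have := fc z x; rewrite /running_time /result /=; lia.
Qed.

End Timed.

(** * Writing an array along an injective index map *)

Lemma nth_scatter_notin (T : eqType) (V : Type) (d : V) (p : T -> nat)
    (v : T -> V) (l : seq T) (r : seq V) (j : nat) :
    j \notin [seq p y | y <- l] ->
  nth d (foldl (fun r y => set_nth d r (p y) (v y)) r l) j = nth d r j.
Proof.
elim: l r => //= y l IH r; rewrite inE negb_or => /andP[jy jl].
by rewrite IH // nth_set_nth /= (negPf jy).
Qed.

Lemma nth_scatter (T : eqType) (V : Type) (d : V) (p : T -> nat) (v : T -> V)
    (l : seq T) (r : seq V) (x : T) :
    uniq [seq p y | y <- l] -> x \in l ->
  nth d (foldl (fun r y => set_nth d r (p y) (v y)) r l) (p x) = v x.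
Proof.
elim: l r => //= y l IH r /andP[yl ul]; rewrite inE => /orP[/eqP->|xl].
  by rewrite nth_scatter_notin // nth_set_nth /= eqxx.
exact: IH.
Qed.

Local Open Scope ring_scope.

(** * A certificate of optimality *)

Section Optimality.

Variables (R : realType) (n : nat) (g : 'rV[R]_n) (G : {set 'I_n}).

Lemma enorm_sqr (x : 'rV[R]_n) : enorm x ^+ 2 = \sum_(i < n) x 0 i ^+ 2.
Proof. by rewrite sqr_sqrtr // sumr_ge0 // => i _; exact: sqr_ge0. Qed.

(** Coordinatewise,
    (y_i - g_i)^2 - (x_i - g_i)^2 - (y_i - x_i)^2 = 2 (x_i - g_i) (y_i - x_i),
    which is 2 a (x_i - y_i) when x_i = g_i - a, and at least that when x_i = 0,
    because there (g_i - a) y_i <= 0.  The lower bounds 2 a (x_i - y_i) sum to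
    0, so the squared distance to g grows by at least |y - x|^2, which gives
    minimality and uniqueness together. *)
Lemma unique_optimal_shift (x : 'rV[R]_n) (a : R) :
    \sum_(i < n) x 0 i = 0 ->
    (forall i, x 0 i = g 0 i - a /\ (i \in G -> x 0 i <= 0) \/
               [/\ i \in G, x 0 i = 0 & a <= g 0 i]) ->
  unique (optimal g G) x.
Proof.
move=> x0 xP.
have xF : feasible G x.
  by split=> // i iG; case: (xP i) => [[_ /(_ iG)]//|[_ -> _]].
have gap y : feasible G y ->
    enorm (x - g) ^+ 2 + enorm (y - x) ^+ 2 <= enorm (y - g) ^+ 2.
  move=> [y0 yG]; rewrite !enorm_sqr -big_split /=.
  have z0 : \sum_(i < n) (2 * a * (x 0 i - y 0 i)) = 0.
    by rewrite -mulr_sumr sumrB x0 y0 subrr mulr0.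
  rewrite -[leLHS]addr0 -[X in _ + X]z0 -big_split /=; apply: ler_sum => i _; rewrite !mxE.
  case: (xP i) => [[-> _]|[iG -> ag]]; first by lra.
  have := yG i iG; have : 0 <= g 0 i - a by rewrite subr_ge0.
  nra.
split.
  split=> // y /gap; apply: le_trans; rewrite lerDl.
  exact: sqr_ge0.
move=> y [yF yO]; have := gap y yF; have := yO x xF => h1 h2.
have : enorm (y - x) ^+ 2 <= 0 by lra.
rewrite enorm_sqr => le0.
have /eqP: \sum_(i < n) (y - x) 0 i ^+ 2 = 0.
  by apply/eqP; rewrite eq_le le0 sumr_ge0 // => i _; exact: sqr_ge0.
rewrite psumr_eq0 => [/allP yx|i _]; last exact: sqr_ge0.
apply/rowP => i; apply/eqP; rewrite eq_sym -subr_eq0.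
by have := yx i (mem_index_enum i); rewrite /= sqrf_eq0 !mxE.
Qed.

End Optimality.

(** * The loop computing the threshold *)

Section Loop.

Variable R : realFieldType.

Definition unfrozen (n : nat) (H : seq bool) : seq nat :=
  [seq k <- iota 0 n | ~~ nth false H k].

Lemma unfrozen_set_nth (n k : nat) (H : seq bool) :
    (k < n)%N -> ~~ nth false H k ->
  perm_eq (unfrozen n H) (k :: unfrozen n (set_nth false H k true)).
Proof.
move=> kn Hk; apply: uniq_perm => [||j].
- exact/filter_uniq/iota_uniq.
- by rewrite /= filter_uniq ?iota_uniq // mem_filter nth_set_nth /= eqxx.
rewrite inE !mem_filter !mem_iota /= nth_set_nth /= add0n.
by case: eqP => [->|_] /=; rewrite ?Hk ?kn.
Qed.

Variables (n : nat) (gs : seq (R * nat)).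
(* The entry of g at sorted position k. *)
Let w k := (nth (0, 0%N) gs k).1.

(** The hypotheses are the loop invariant, with the average stated as
    a * c = s to avoid division, c being the number of positions outside H; the
    equation c + i = n + 1 says that the divisor n - i used by the iteration is
    c - 1, the number of positions left after a removal. *)
Lemma shrink_loopP (i : nat) (l : seq nat) (s a : R) (H : seq bool) :
    (forall k, k \in l -> (k < n)%N /\ ~~ nth false H k) -> uniq l ->
    pairwise (fun j k => w k <= w j) l ->
    (size (unfrozen n H) + i = n.+1)%N ->
    s = \sum_(k <- unfrozen n H) w k -> a * (size (unfrozen n H))%:R = s ->
    (forall k, nth false H k -> a <= w k) ->
  let: (a', H') := result (shrink_loop n gs i l s a H) in
  [/\ a' * (size (unfrozen n H'))%:R = \sum_(k <- unfrozen n H') w k,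
      forall k, nth false H' k -> a' <= w k,
      forall k, nth false H k -> nth false H' k,
      forall k, nth false H' k -> nth false H k \/ k \in l &
      forall k, k \in l -> ~~ nth false H' k -> w k <= a'].
Proof.
elim: l i s a H => [|k l IH] i s a H lH /=.
  by move=> _ _ _ -> aE aH; split=> //; left.
move=> /andP[kl ul] /andP[wk wl] szE sE aE aH; rewrite -/(w k).
have [kn kH] := lH k (mem_head _ _).
have pE := unfrozen_set_nth kn kH; set H1 := set_nth _ _ _ _ in pE.
have szE1 := perm_size pE; rewrite /= in szE1.
have sE1 : s = w k + \sum_(j <- unfrozen n H1) w j.
  by rewrite sE (perm_big _ pE) big_cons.
case: ifP => [a_lt|/negbT]; last first.
  rewrite -leNgt => wa /=.
  rewrite -sE aE; split=> //; first by left.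
  move=> j; rewrite inE => /orP[/eqP->//|jl _].
  by apply: le_trans wa; move/allP: wk; apply.
move: aE; rewrite szE1.
set c := size (unfrozen n H1) => aE.
(* If k were the only remaining position, a would be w k itself. *)
have c_gt0 : (0 < c)%N.
  rewrite lt0n; apply/negP => c0; move: aE sE1; rewrite (eqP c0).
  have -> : unfrozen n H1 = [::] by apply: size0nil; exact/eqP.
  rewrite big_nil; move: a_lt; lra.
have niE : (n - i)%N = c by lia.
have cR : 0 < c%:R :> R by rewrite ltr0n.
have a1c : (s - w k) / c%:R * c%:R = s - w k by rewrite divfK // gt_eqF.
(* Removing an entry above the average lowers the average. *)
have a1_le : (s - w k) / c%:R <= a.
  by rewrite ler_pdivrMr // -aE -natr1; move: a_lt; lra.
rewrite /result /= in IH *; rewrite niE -/(w k) -/H1.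
have := IH i.+1 (s - w k) ((s - w k) / c%:R) H1.
case: (shrink_loop _ _ _ _ _ _ _).1 => a' H' IH'.
have H1E j : nth false H1 j = (j == k) || nth false H j.
  by rewrite nth_set_nth /=; case: eqP.
case: IH' => //.
- move=> j jl; have [jn jH] := lH j (mem_behead (s := k :: l) jl).
  rewrite H1E negb_or jH jn andbT; split=> //.
  by apply: contraNneq kl => <-.
- by move: szE; rewrite szE1 -/c addSnnS.
- by rewrite sE1 addrAC subrr add0r.
- move=> j; rewrite H1E => /orP[/eqP->|/aH]; last exact: le_trans.
  exact/ltW/(le_lt_trans a1_le).
move=> H'1 H'2 HH' H'3 H'4; split=> // j.
- by move=> jH; apply: HH'; rewrite H1E jH orbT.
- move=> /H'3; rewrite H1E inE.
  by case=> [/orP[->|]|->]; [right | left | right; rewrite orbT].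
- rewrite inE => /orP[/eqP->|]; last exact: H'4.
  by rewrite HH' // H1E eqxx.
Qed.

End Loop.

(** * Correctness on arrays *)

Section ArrayAlgorithm.

Variables (R : realFieldType) (srt : sorting_algorithm).

Definition entry_ge : rel (R * nat) := fun p q => q.1 <= p.1.

Lemma entry_ge_total : total entry_ge.
Proof. by move=> p q; exact: le_total. Qed.

Lemma entry_ge_trans : transitive entry_ge.
Proof. by move=> q p r qp rq; exact: le_trans rq qp. Qed.

(** Position k of the sorted array holds the entry of original index sg k, and
    sg permutes 0, ..., n - 1 with inverse pos.  So the list of positions
    passed to the loop enumerates exactly the k with sg k in G, by decreasing
    entries, and the last pass of the program stores the value computed at k in
    cell sg k. *)
Lemma gps_arrayP (g : seq R) (G : seq nat) (n : nat) :
    (0 < n)%N -> uniq G -> (forall j, j \in G -> (j < n)%N) ->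
  exists a : R, let x := result (gps_array srt g G n) in
    \sum_(j <- iota 0 n) x`_j = 0 /\
    forall j, (j < n)%N ->
      x`_j = g`_j - a /\ (j \in G -> x`_j <= 0) \/
      [/\ j \in G, x`_j = 0 & a <= g`_j].
Proof.
move=> n_gt0 uG Gn.
rewrite /gps_array !result_bind !result_for_map.
set tagged := [seq _ | j <- iota 0 n].
have taggedE : tagged = [seq (g`_j, j) | j <- iota 0 n] by [].
set gs := result (sort_run srt _ tagged).
have gs_perm : perm_eq gs tagged.
  exact: sort_run_perm entry_ge_total entry_ge_trans.
have gs_sorted : sorted entry_ge gs.
  exact: sort_run_sorted entry_ge_total entry_ge_trans.
clearbody gs.
have sz_gs : size gs = n by rewrite (perm_size gs_perm) taggedE size_map size_iota.
pose w k := (nth (0, 0%N) gs k).1; pose sg k := (nth (0, 0%N) gs k).2.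
have sg_perm : perm_eq [seq sg k | k <- iota 0 n] (iota 0 n).
  have -> : [seq sg k | k <- iota 0 n] = [seq p.2 | p <- gs].
    by rewrite -[in RHS](mkseq_nth (0, 0%N) gs) -map_comp sz_gs.
  by rewrite (perm_trans (perm_map _ gs_perm)) // taggedE -map_comp map_id.
have sg_uniq : uniq [seq sg k | k <- iota 0 n].
  by rewrite (perm_uniq sg_perm) iota_uniq.
have wE k : (k < n)%N -> w k = g`_(sg k).
  move=> kn; have : nth (0, 0%N) gs k \in tagged.
    by rewrite -(perm_mem gs_perm) mem_nth // sz_gs.
  by rewrite taggedE /w /sg => /mapP[j _ ->].
have sg_surj j : (j < n)%N -> exists2 k, (k < n)%N & j = sg k.
  move=> jn; have : j \in [seq sg k | k <- iota 0 n].
    by rewrite (perm_mem sg_perm) mem_iota.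
  by case/mapP => k; rewrite mem_iota => kn ->; exists k.
rewrite !result_for_fold.
set pos := foldl _ (result (alloc n 0%N)) _.
have posE k : (k < n)%N -> nth 0%N pos (sg k) = k.
  by move=> kn; apply: (@nth_scatter _ _ 0%N sg id); rewrite ?mem_iota.
clearbody pos.
set Gs := result (sort_run srt leq _).
have Gs_perm : perm_eq Gs [seq nth 0%N pos j | j <- G].
  exact: sort_run_perm leq_total leq_trans.
have Gs_sorted : sorted leq Gs.
  exact: sort_run_sorted leq_total leq_trans.
clearbody Gs.
set s := foldl _ 0 _.
have sE : s = \sum_(k <- iota 0 n) w k.
  have sumE z l : foldl (fun z k => z + w k) z l = z + \sum_(k <- l) w k.
    elim: l z => [|k l IH] z /=; first by rewrite big_nil addr0.
    by rewrite IH big_cons addrA.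
  by rewrite -[RHS]add0r -sumE.
clearbody s.
set aH := result (shrink_loop _ _ _ _ _ _ _).
have GsP k : k \in Gs -> (k < n)%N /\ sg k \in G.
  rewrite (perm_mem Gs_perm) => /mapP[j jG ->].
  have [k' k'n jE] := sg_surj j (Gn j jG).
  by rewrite jE posE // -jE.
have mem_Gs k : (k < n)%N -> sg k \in G -> k \in Gs.
  by move=> kn kG; rewrite (perm_mem Gs_perm) -{1}(posE k kn); apply: map_f.
have Gs_uniq : uniq Gs.
  rewrite (perm_uniq Gs_perm) map_inj_in_uniq // => j1 j2 /Gn/sg_surj[k1 kn1 ->].
  by move=> /Gn/sg_surj[k2 kn2 ->]; rewrite !posE // => ->.
have Gs_pairwise : pairwise (fun j k => w k <= w j) Gs.
  have : pairwise leq Gs by rewrite -sorted_pairwise //; exact: leq_trans.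
  apply: sub_in_pairwise => // j k /GsP[jn _] /GsP[kn _] jk.
  apply: (sorted_leq_nth entry_ge_trans (fun p => lexx p.1) (0, 0%N) gs_sorted);
    by rewrite ?inE ?sz_gs.
have unfrozen0 : unfrozen n (nseq n false) = iota 0 n.
  by apply/all_filterP/allP => k _; rewrite nth_nseq if_same.
have nR : n%:R != 0 :> R by rewrite pnatr_eq0 -lt0n.
have := @shrink_loopP R n gs 1 Gs s (s / n%:R) (nseq n false).
rewrite unfrozen0 size_iota -/aH; case: aH => a H /= loopP.
set x := [seq result _ | k <- iota 0 n].
have xE k : (k < n)%N -> x`_k = if nth false H k then 0 else w k - a.
  move=> kn; rewrite (nth_map 0%N) ?size_iota // nth_iota // add0n.
  by rewrite /result /=; case: ifP.
clearbody x.
set r := foldl _ _ _.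
have rE k : (k < n)%N -> r`_(sg k) = if nth false H k then 0 else w k - a.
  move=> kn; rewrite -xE //.
  by apply: (@nth_scatter _ _ 0 sg (fun k => x`_k)); rewrite ?mem_iota.
clearbody r.
case: loopP; rewrite ?addn1 ?divfK //.
- move=> k kGs; have [kn _] := GsP k kGs; split=> //.
  by rewrite nth_nseq if_same.
- by move=> k; rewrite nth_nseq if_same.
move=> a_avg aH _ HG Ga; exists a; split.
  rewrite -(perm_big _ sg_perm) big_map big_seq.
  under eq_bigr => k do [rewrite mem_iota => kn; rewrite rE // -if_neg].
  rewrite -big_seq -big_mkcond /= -big_filter -/(unfrozen n H).
  by rewrite sumrB -a_avg big_const_seq count_predT iter_addr_0 mulr_natr subrr.
move=> _ /sg_surj[k kn ->]; rewrite rE // -wE //.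
case: ifP => [kH|/negbT kH].
  right; split=> //; last exact: aH.
  have [|/GsP[]//] := HG k kH; by rewrite nth_nseq if_same.
by left; split=> // kG; rewrite subr_le0; apply: Ga => //; exact: mem_Gs.
Qed.

End ArrayAlgorithm.

(** * Running time *)

Section RunningTime.

Variables (R : realFieldType) (srt : sorting_algorithm).

Lemma running_time_shrink_loop (n : nat) (gs : seq (R * nat)) (i : nat)
    (l : seq nat) (s a : R) (H : seq bool) :
  (running_time (shrink_loop n gs i l s a H) <= 8 * size l)%N.
Proof.
elim: l i s a H => //= k l IH i s a H; rewrite /running_time /=.
case: ifP => _; last by rewrite /=; lia.
have := IH i.+1 (s - (nth (0, 0%N) gs k).1)
  ((s - (nth (0, 0%N) gs k).1) / (n - i)%:R) (set_nth false H k true).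
rewrite /running_time /result /=; lia.
Qed.

(** Every instruction other than the two sorts is a loop of constant-cost
    iterations, an allocation or a single operation. *)
Lemma running_time_gps_array (t : nat -> nat) (g : seq R) (G : seq nat)
    (n : nat) :
    (forall (T : eqType) (leT : rel T) (s : seq T),
       total leT -> transitive leT ->
       (running_time (sort_run srt leT s) <= t (size s))%N) ->
  (running_time (gps_array srt g G n) <=
   19 * n + 1 + 10 * size G + t n + t (size G))%N.
Proof.
move=> sort_time.
(* One summand per instruction, in program order. *)
apply: (@leq_trans (2 * n + (t n + (n + (3 * n + (2 * size G + (t (size G) +
  (3 * n + (1 + (n + (8 * size G + (4 * n + (n + 4 * n))))))))))))%N);
  last by lia.
have sz0 : size (iota 0 n) = n by rewrite size_iota.
rewrite /gps_array.
apply: running_time_bind.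
  by rewrite -[n in leqRHS]sz0; apply: running_time_for_map.
apply: running_time_bind.
  rewrite result_for_map; apply: leq_trans (sort_time _ _ _ _ _) _.
  - exact: entry_ge_total.
  - exact: entry_ge_trans.
  - by rewrite size_map sz0.
apply: running_time_bind => //.
apply: running_time_bind.
  by rewrite -[n in leqRHS]sz0; apply: running_time_for_fold.
apply: running_time_bind; first exact: running_time_for_map.
apply: running_time_bind.
  rewrite result_for_map; apply: leq_trans (sort_time _ _ _ _ _) _.
  - exact: leq_total.
  - exact: leq_trans.
  - by rewrite size_map.
apply: running_time_bind.
  by rewrite -[n in leqRHS]sz0; apply: running_time_for_fold.
apply: running_time_bind => //.
apply: running_time_bind => //.
apply: running_time_bind.
  apply: leq_trans (running_time_shrink_loop _ _ _ _ _ _ _) _.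
  rewrite leq_mul2l /= (perm_size (sort_run_perm srt _ leq_total leq_trans)).
  by rewrite result_for_map size_map.
apply: running_time_bind.
  rewrite -[n in leqRHS]sz0; apply: running_time_for_map => k.
  by apply: (@running_time_bind _ _ _ _ 1 2) => //; case: ifP.
apply: running_time_bind => //.
by rewrite -[n in leqRHS]sz0; apply: running_time_for_fold.
Qed.

End RunningTime.

(** * Linearithmic growth *)

Section Linearithmic.

Variable R : realType.

Lemma nlogn_ge0 (n : nat) : 0 <= n%:R * ln n%:R :> R.
Proof.
case: n => [|n]; first by rewrite mul0r.
by rewrite mulr_ge0 // ln_ge0 // ler1n.
Qed.

Lemma nlogn_le (m n : nat) : (m <= n)%N ->
  m%:R * ln m%:R <= n%:R * ln n%:R :> R.
Proof.
case: m => [|m] mn; first by rewrite mul0r nlogn_ge0.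
apply: ler_pM; rewrite ?ler_nat // ?ln_ge0 ?ler1n //.
by rewrite ler_ln ?ler_nat // posrE ltr0n // (leq_trans _ mn).
Qed.

(** A bound valid for all n instead of eventually: the finitely many exceptional
    values go into the term K (n + 1), which is itself absorbed by n ln n for
    n >= 2. *)
Lemma O_nlognP (t : nat -> nat) :
  O_nlogn R t <->
  exists K C : R, [/\ 0 <= K, 0 <= C &
    forall n : nat, (t n)%:R <= K * n.+1%:R + C * (n%:R * ln n%:R)].
Proof.
split.
  move=> /eqO_exP[C C_gt0 [N _ tN]].
  exists (\max_(n < N) t n)%:R, C; split=> [||n]; [exact: ler0n|exact: ltW|].
  have [nN|Nn] := ltnP n N.
    rewrite -[leLHS]addr0; apply: lerD; last first.
      by apply: mulr_ge0; [exact: ltW|exact: nlogn_ge0].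
    rewrite -natrM ler_nat; apply: leq_trans (leq_pmulr _ _) => //.
    exact: (@leq_bigmax _ _ (Ordinal nN)).
  rewrite -[leLHS]add0r; apply: lerD; first by rewrite mulr_ge0.
  by have := tN n Nn; rewrite /= !ger0_norm ?nlogn_ge0.
move=> [K [C [K_ge0 C_ge0 tKC]]]; apply/eqO_exP.
have ln2 : 0 < ln 2 :> R by rewrite ln_gt0 // ltr1n.
exists (K * 2 / ln 2 + C + 1).
  by rewrite ltr_wpDl // addr_ge0 // divr_ge0 ?mulr_ge0 // ltW.
exists 2%N => // n /= n2.
rewrite [leLHS]ger0_norm // [X in _ * X]ger0_norm ?nlogn_ge0 //.
apply: (le_trans (tKC n)); rewrite -addrA mulrDl; apply: lerD.
  (* From 2 <= n on, n + 1 <= 2 n <= 2 n ln n / ln 2. *)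
  rewrite -!mulrA ler_wpM2l // (@le_trans _ _ (2 * n%:R)) //.
    by rewrite -natrM ler_nat; lia.
  rewrite ler_wpM2l // ler_pdivlMl // mulrC ler_wpM2l //.
  by rewrite ler_ln ?ler_nat ?posrE ?ltr0n //; lia.
by rewrite ler_wpM2r ?nlogn_ge0 // lerDl.
Qed.

(** By [O_nlognP] the value of t at any k <= n is bounded by a nondecreasing
    function of k, hence by the value of that function at n. *)
Lemma O_nlogn_prefix_max (t : nat -> nat) (c : nat) : O_nlogn R t ->
  O_nlogn R (fun n => c * n.+1 + 2 * \max_(k < n.+1) t k)%N.
Proof.
move=> /O_nlognP[K [C [K_ge0 C_ge0 tKC]]]; apply/O_nlognP.
exists (c%:R + 2 * K), (2 * C); split=> [||n]; rewrite ?addr_ge0 ?mulr_ge0 //.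
have [|k ->] := @bigop.eq_bigmax _ (fun k : 'I_n.+1 => t k).
  by rewrite card_ord.
have kn : (k <= n)%N by rewrite -ltnS.
rewrite natrD !natrM [X in _ <= X + _]mulrDl -addrA lerD2l -!mulrA -mulrDr ler_wpM2l //.
apply: le_trans (tKC k) _; apply: lerD; apply: ler_wpM2l => //.
  by rewrite ler_nat.
exact: nlogn_le.
Qed.

End Linearithmic.

(** * Correctness and running time of the algorithm *)

Theorem mainTheorem1 (R : realType) (srt : sorting_algorithm) :
  (forall (n : nat) (g : 'rV[R]_n) (G : {set 'I_n}), (1 <= n)%N ->
     unique (optimal g G) (gps_output srt g G)) /\
  (nlogn_sorting R srt ->
     exists2 t : nat -> nat, O_nlogn R t &
       forall (n : nat) (g : 'rV[R]_n) (G : {set 'I_n}), (1 <= n)%N ->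
         (running_time (gps srt g G) <= t n)%N).
Proof.
split=> [n g G n_gt0|[t tO sort_time]].
  have uG : uniq [seq val i | i <- enum G].
    by rewrite map_inj_uniq ?enum_uniq //; exact: val_inj.
  have Gn j : j \in [seq val i | i <- enum G] -> (j < n)%N.
    by case/mapP=> i _ ->; exact: ltn_ord.
  have [a [sum0 outP]] :=
    @gps_arrayP _ srt [seq g 0 i | i <- enum 'I_n] _ _ n_gt0 uG Gn.
  have gE (i : 'I_n) : [seq g 0 i | i <- enum 'I_n]`_i = g 0 i.
    by rewrite (nth_map i) ?size_enum_ord // nth_ord_enum.
  apply: (@unique_optimal_shift _ _ _ _ _ a).
    rewrite -[RHS]sum0 -val_enum_ord big_map big_enum.
    apply: eq_bigr => i _; by rewrite /gps_output mxE.
  move=> i; rewrite /gps_output mxE -gE -mem_enum -(mem_map val_inj).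
  exact: outP.
exists (fun n => 29 * n.+1 + 2 * \max_(k < n.+1) t k)%N.
  exact: O_nlogn_prefix_max.
move=> n g G _; apply: leq_trans (running_time_gps_array _ _ _ sort_time) _.
rewrite size_map.
have Gn : (size (enum G) <= n)%N by rewrite -cardE -[leqRHS]card_ord max_card.
have t_le k : (k <= n)%N -> (t k <= \max_(k < n.+1) t k)%N.
  rewrite -ltnS => kn.
  exact: (@leq_bigmax _ (fun k : 'I_n.+1 => t k) (Ordinal kn)).
have := t_le _ (leqnn n); have := t_le _ Gn.
by move: (\max_(k < n.+1) t k) (size (enum G)) Gn => M m /=; lia.
Qed.
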